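(* For any $p,q,\mu\in(0,1)$ and $c>0$, there is no $*$-algebra isomorphism between $\mathcal{O}(S^2_{pq})$ and $\mathcal{O}(S^2_{\mu c})$.
   Context: For $r\in(0,1)$, $\mathcal{O}(D_r)$ is the universal unital $*$-algebra over $\mathbb{C}$ generated by $z$ with $z^*z-r\,zz^*=1-r$; $\mathcal{O}(S^1)$ is the universal $*$-algebra generated by a unitary $u$; and $\pi_r:\mathcal{O}(D_r)\to\mathcal{O}(S^1)$ is the $*$-homomorphism with $\pi_r(z)=u$. For $p,q\in(0,1)$, \[ \mathcal{O}(S^2_{pq})=\{(f,g)\in\mathcal{O}(D_p)\oplus\mathcal{O}(D_q)\mid\pi_p(f)=\pi_q(g)\}. \] Equivalently (known identification), $\mathcal{O}(S^2_{pq})$ is the universal unital $*$-algebra generated by $f_0,f_1$ with relations $f_0=f_0^*$, $f_1^*f_1-q f_1f_1^*=(p-q)f_0+1-p$, $f_0f_1-pf_1f_0=(1-p)f_1$, $(1-f_0)(f_1f_1^*-f_0)=0$; the isomorphism sends $f_1\mapsto(x,y)$, $f_0\mapsto(xx^*,1)$, with $x,y$ the generators of $\mathcal{O}(D_p)$, $\mathcal{O}(D_q)$. $\mathcal{O}(S^2_{\mu c})$ is the polynomial $*$-algebra of the Podleś quantum sphere: for $\mu\in(0,1)$, $c>0$, it is the universal unital $*$-algebra generated by $A,B$ with relations $A=A^*$, $BA=\mu^2AB$, $B^*B=A-A^2+c$, $BB^*=\mu^2A-\mu^4A^2+c$. *)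

(* Defs.v *)
From HB Require Import structures.
From mathcomp Require Import all_boot all_order all_algebra.
From mathcomp Require Import generic_quotient complex.
From mathcomp Require Import boolp classical_sets reals.

Set Implicit Arguments.
Unset Strict Implicit.
Unset Printing Implicit Defensive.

Import Order.TTheory GRing.Theory Num.Theory.
Local Open Scope ring_scope.
Local Open Scope complex_scope.
Local Open Scope quotient_scope.

HB.mixin Record hasStar (C : numClosedFieldType) A of GRing.Algebra C A := {
  star : A -> A;
  starD : forall x y, star (x + y) = star x + star y;
  starZ : forall (a : C) x, star (a *: x) = Num.conj a *: star x;
  starM : forall x y, star (x * y) = star y * star x;
  starK : forall x, star (star x) = x
}.

#[short(type="starAlgType")]
HB.structure Definition StarAlgebra (C : numClosedFieldType) :=
  {A of GRing.Algebra C A & hasStar C A}.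

Section StarTheory.
Variables (C : numClosedFieldType) (A : starAlgType C).
Implicit Types x y : A.

Lemma star0 : star (0 : A) = 0.
Proof. by rewrite -(scale0r (0 : A)) starZ conjC0 !scale0r. Qed.

Lemma starN x : star (- x) = - star x.
Proof. by rewrite -scaleN1r starZ rmorphN1 scaleN1r. Qed.

Lemma starB x y : star (x - y) = star x - star y.
Proof. by rewrite starD starN. Qed.

Lemma star1 : star (1 : A) = 1.
Proof.
have h : star (star (1 : A)) = 1 by exact: starK.
by rewrite -[LHS]mul1r -{1}h -starM mul1r.
Qed.

End StarTheory.

Definition star_preserving (C : numClosedFieldType) (A B : starAlgType C)
  (f : A -> B) : Prop := forall x, f (star x) = star (f x).

Definition star_isomorphic (C : numClosedFieldType) (A B : starAlgType C) :
  Prop := exists f : {lrmorphism A -> B}, bijective f /\ star_preserving f.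

Section Regular.
Variable C : numClosedFieldType.

Let starM_regular (x y : C^o) :
  Num.conj (x * y : C) = Num.conj (y : C) * Num.conj (x : C).
Proof. by rewrite rmorphM mulrC. Qed.

HB.instance Definition _ := hasStar.Build C C^o
  (star := fun x : C^o => Num.conj (x : C))
  (fun x y => rmorphD _ (x : C) y) (fun a x => rmorphM _ a (x : C))
  starM_regular (fun x => conjCK (x : C)).

End Regular.

Section Product.
Variables (C : numClosedFieldType) (A B : starAlgType C).
Let AB := (A * B)%type.
Let starp (x : AB) : AB := (star x.1, star x.2).

Let starpD x y : starp (x + y) = starp x + starp y.
Proof. by rewrite /starp !starD. Qed.
Let starpZ (a : C) x : starp (a *: x) = Num.conj a *: starp x.
Proof. by rewrite /starp !starZ. Qed.
Let starpM x y : starp (x * y) = starp y * starp x.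
Proof. by rewrite /starp !starM. Qed.
Let starpK x : starp (starp x) = x.
Proof. by case: x => a b; rewrite /starp !starK. Qed.

HB.instance Definition _ := hasStar.Build C (A * B)%type
  starpD starpZ starpM starpK.

End Product.

(* Formal *-polynomials over the scalars C in the indeterminates X. *)
Inductive sterm (C X : Type) : Type :=
  | TVar of X
  | TZero
  | TOne
  | TAdd of sterm C X & sterm C X
  | TOpp of sterm C X
  | TScale of C & sterm C X
  | TMul of sterm C X & sterm C X
  | TStar of sterm C X.
Arguments TVar {C X}.
Arguments TZero {C X}.
Arguments TOne {C X}.

HB.instance Definition _ (C X : Type) := gen_eqMixin (sterm C X).
HB.instance Definition _ (C X : Type) := gen_choiceMixin (sterm C X).

Declare Scope sterm_scope.
Delimit Scope sterm_scope with stm.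
Bind Scope sterm_scope with sterm.
Notation "0" := TZero : sterm_scope.
Notation "1" := TOne : sterm_scope.
Notation "s + t" := (TAdd s t) : sterm_scope.
Notation "- s" := (TOpp s) : sterm_scope.
Notation "s - t" := (TAdd s (TOpp t)) : sterm_scope.
Notation "s * t" := (TMul s t) : sterm_scope.
Notation "a *: s" := (TScale a s) : sterm_scope.
Notation "s ^*" := (TStar s) : sterm_scope.

Fixpoint seval (C : numClosedFieldType) (X : Type) (A : starAlgType C)
    (v : X -> A) (t : sterm C X) : A :=
  match t with
  | TVar x => v x
  | TZero => 0
  | TOne => 1
  | TAdd s t => seval v s + seval v t
  | TOpp s => - seval v s
  | TScale a s => a *: seval v s
  | TMul s t => seval v s * seval v t
  | TStar s => star (seval v s)
  end.

Definition satisfies (C : numClosedFieldType) (X : Type) (A : starAlgType C)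
    (rels : set (sterm C X * sterm C X)) (v : X -> A) : Prop :=
  forall s t, rels (s, t) -> seval v s = seval v t.

(* The library's algebras are nonzero by definition, whereas an arbitrary
   presentation may collapse; pmodel rules this out by asking that the
   relations be satisfied somewhere in C itself. *)
Record presentation (C : numClosedFieldType) := Presentation {
  pgen : Type;
  prels : set (sterm C pgen * sterm C pgen);
  pmodel : exists v : pgen -> C^o, satisfies prels v
}.

(* The least congruence on terms that contains the relations and whose
   quotient is a unital *-algebra over C. *)
Inductive scong (C : numClosedFieldType) (P : presentation C) :
    sterm C (pgen P) -> sterm C (pgen P) -> Prop :=
  | SRel s t : prels (s, t) -> scong s t
  | SRefl s : scong s s
  | SSym s t : scong s t -> scong t s
  | STrans s t u : scong s t -> scong t u -> scong s u
  | SCongAdd s s' t t' : scong s s' -> scong t t' -> scong (s + t) (s' + t')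
  | SCongOpp s s' : scong s s' -> scong (- s) (- s')
  | SCongScale a s s' : scong s s' -> scong (a *: s) (a *: s')
  | SCongMul s s' t t' : scong s s' -> scong t t' -> scong (s * t) (s' * t')
  | SCongStar s s' : scong s s' -> scong (s^*) (s'^*)
  | SAddA s t u : scong (s + (t + u)) (s + t + u)
  | SAddC s t : scong (s + t) (t + s)
  | SAdd0 s : scong (0 + s) s
  | SAddN s : scong (- s + s) 0
  | SScaleA a b s : scong (a *: (b *: s)) ((a * b)%R *: s)
  | SScale1 s : scong (1%R *: s) s
  | SScaleDr a s t : scong (a *: (s + t)) (a *: s + a *: t)
  | SScaleDl a b s : scong ((a + b)%R *: s) (a *: s + b *: s)
  | SMulA s t u : scong (s * (t * u)) (s * t * u)
  | SMul1l s : scong (1 * s) s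
  | SMul1r s : scong (s * 1) s
  | SMulDl s t u : scong ((s + t) * u) (s * u + t * u)
  | SMulDr s t u : scong (s * (t + u)) (s * t + s * u)
  | SScaleAl a s t : scong (a *: (s * t)) ((a *: s) * t)
  | SScaleAr a s t : scong (a *: (s * t)) (s * (a *: t))
  | SStarD s t : scong ((s + t)^*) (s^* + t^*)
  | SStarZ a s : scong ((a *: s)^*) (Num.conj a *: s^*)
  | SStarM s t : scong ((s * t)^*) (t^* * s^*)
  | SStarK s : scong ((s^*)^*) s.

Lemma scong_eval (C : numClosedFieldType) (P : presentation C)
    (A : starAlgType C) (v : pgen P -> A) s t :
  satisfies (@prels C P) v -> scong s t -> seval v s = seval v t.
Proof.
move=> hv; elim=> {s t} //=.
- by move=> s t u _ -> _ ->.
- by move=> s s' t t' _ -> _ ->.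
- by move=> s s' _ ->.
- by move=> a s s' _ ->.
- by move=> s s' t t' _ -> _ ->.
- by move=> s s' _ ->.
- by move=> *; rewrite addrA.
- by move=> *; rewrite addrC.
- by move=> *; rewrite add0r.
- by move=> *; rewrite addNr.
- by move=> *; rewrite scalerA.
- by move=> *; rewrite scale1r.
- by move=> *; rewrite scalerDr.
- by move=> *; rewrite scalerDl.
- by move=> *; rewrite mulrA.
- by move=> *; rewrite mul1r.
- by move=> *; rewrite mulr1.
- by move=> *; rewrite mulrDl.
- by move=> *; rewrite mulrDr.
- by move=> *; rewrite scalerAl.
- by move=> *; rewrite scalerAr.
- by move=> *; rewrite starD.
- by move=> *; rewrite starZ.
- by move=> *; rewrite starM.
- by move=> *; rewrite starK.
Qed.

Section Presented.
Variables (C : numClosedFieldType) (P : presentation C).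

Definition sequiv (s t : sterm C (pgen P)) : bool := `[< scong s t >].

Let sequiv_refl : reflexive sequiv.
Proof. by move=> s; apply/asboolP/SRefl. Qed.
Let sequiv_sym : symmetric sequiv.
Proof. by move=> s t; apply/asboolP/asboolP; exact: SSym. Qed.
Let sequiv_trans : transitive sequiv.
Proof.
by move=> t s u /asboolP st /asboolP tu; apply/asboolP; exact: STrans st tu.
Qed.

Canonical sequiv_equivRel := EquivRel sequiv sequiv_refl sequiv_sym sequiv_trans.

Definition presented : Type := {eq_quot sequiv_equivRel}.
HB.instance Definition _ := Choice.on presented.

Definition pclass (s : sterm C (pgen P)) : presented :=
  \pi_({eq_quot sequiv_equivRel}) s.

Definition prepr (x : presented) : sterm C (pgen P) :=
  repr (x : {eq_quot sequiv_equivRel}).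

Lemma preprK x : pclass (prepr x) = x.
Proof. exact: (@reprK _ {eq_quot sequiv_equivRel}). Qed.

Lemma pclassE s t : pclass s = pclass t <-> scong s t.
Proof.
split=> [/eqquotP/asboolP //|st].
by apply/eqquotP/asboolP.
Qed.

Lemma pclassK s : scong (prepr (pclass s)) s.
Proof. by apply/pclassE; rewrite preprK. Qed.

Let add x y := pclass (prepr x + prepr y).
Let opp x := pclass (- prepr x).
Let scale a x := pclass (a *: prepr x).
Let mul x y := pclass (prepr x * prepr y).
Let pstar x := pclass ((prepr x)^*).

Let addE s t : add (pclass s) (pclass t) = pclass (s + t).
Proof. by apply/pclassE/SCongAdd; exact: pclassK. Qed.
Let oppE s : opp (pclass s) = pclass (- s).
Proof. by apply/pclassE/SCongOpp; exact: pclassK. Qed.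
Let scaleE a s : scale a (pclass s) = pclass (a *: s).
Proof. by apply/pclassE/SCongScale; exact: pclassK. Qed.
Let mulE s t : mul (pclass s) (pclass t) = pclass (s * t).
Proof. by apply/pclassE/SCongMul; exact: pclassK. Qed.
Let pstarE s : pstar (pclass s) = pclass (s^*).
Proof. by apply/pclassE/SCongStar; exact: pclassK. Qed.

Let addA : associative add.
Proof.
move=> x y z; rewrite -(preprK x) -(preprK y) -(preprK z) !addE.
by apply/pclassE/SAddA.
Qed.
Let addC : commutative add.
Proof.
by move=> x y; rewrite -(preprK x) -(preprK y) !addE; apply/pclassE/SAddC.
Qed.
Let add0 : left_id (pclass 0) add.
Proof. by move=> x; rewrite -(preprK x) addE; apply/pclassE/SAdd0. Qed.
Let addN : left_inverse (pclass 0) opp add.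
Proof. by move=> x; rewrite -(preprK x) oppE addE; apply/pclassE/SAddN. Qed.

HB.instance Definition _ := GRing.isZmodule.Build presented addA addC add0 addN.

Let mulA : associative mul.
Proof.
move=> x y z; rewrite -(preprK x) -(preprK y) -(preprK z) !mulE.
by apply/pclassE/SMulA.
Qed.
Let mul1l : left_id (pclass 1) mul.
Proof. by move=> x; rewrite -(preprK x) mulE; apply/pclassE/SMul1l. Qed.
Let mul1r : right_id (pclass 1) mul.
Proof. by move=> x; rewrite -(preprK x) mulE; apply/pclassE/SMul1r. Qed.
Let mulDl : left_distributive mul add.
Proof.
move=> x y z; rewrite -(preprK x) -(preprK y) -(preprK z) !(mulE, addE).
by apply/pclassE/SMulDl.
Qed.
Let mulDr : right_distributive mul add.
Proof.
move=> x y z; rewrite -(preprK x) -(preprK y) -(preprK z) !(mulE, addE).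
by apply/pclassE/SMulDr.
Qed.
Let one_neq0 : pclass 1 != pclass 0.
Proof.
have [v hv] := pmodel P; apply/eqP => /pclassE /(scong_eval hv) /= /eqP.
by rewrite oner_eq0.
Qed.

HB.instance Definition _ := GRing.Zmodule_isNzRing.Build presented
  mulA mul1l mul1r mulDl mulDr one_neq0.

Let scaleA a b x : scale a (scale b x) = scale (a * b)%R x.
Proof. by rewrite -(preprK x) !scaleE; apply/pclassE/SScaleA. Qed.
Let scale1 : left_id 1%R scale.
Proof. by move=> x; rewrite -(preprK x) !scaleE; apply/pclassE/SScale1. Qed.
Let scaleDr : right_distributive scale (+%R : presented -> presented -> presented).
Proof.
move=> a x y; rewrite -(preprK x) -(preprK y).
rewrite -[(_ + _)%R]/(add _ _) -[RHS]/(add _ _) !(addE, scaleE).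
by apply/pclassE/SScaleDr.
Qed.
Let scaleDl x : {morph scale^~ x : a b / (a + b)%R}.
Proof.
move=> a b; rewrite -(preprK x) -[RHS]/(add _ _) !(addE, scaleE).
by apply/pclassE/SScaleDl.
Qed.

HB.instance Definition _ := GRing.Zmodule_isLmodule.Build C presented
  scaleA scale1 scaleDr scaleDl.

Let scaleAl (a : C) (x y : presented) : a *: (x * y) = (a *: x) * y.
Proof.
rewrite -(preprK x) -(preprK y) -[LHS]/(scale _ (mul _ _)).
rewrite -[RHS]/(mul (scale _ _) _) !(mulE, scaleE).
by apply/pclassE/SScaleAl.
Qed.
HB.instance Definition _ := GRing.Lmodule_isLalgebra.Build C presented scaleAl.

Let scaleAr (a : C) (x y : presented) : a *: (x * y) = x * (a *: y).
Proof.
rewrite -(preprK x) -(preprK y) -[LHS]/(scale _ (mul _ _)).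
rewrite -[RHS]/(mul _ (scale _ _)) !(mulE, scaleE).
by apply/pclassE/SScaleAr.
Qed.
HB.instance Definition _ := GRing.Lalgebra_isAlgebra.Build C presented scaleAr.

Let pstarD (x y : presented) : pstar (x + y) = pstar x + pstar y.
Proof.
rewrite -(preprK x) -(preprK y) -[LHS]/(pstar (add _ _)).
by rewrite -[RHS]/(add _ _) !(addE, pstarE); apply/pclassE/SStarD.
Qed.
Let pstarZ (a : C) (x : presented) : pstar (a *: x) = Num.conj a *: pstar x.
Proof.
rewrite -(preprK x) -[LHS]/(pstar (scale _ _)).
by rewrite -[RHS]/(scale _ _) !(scaleE, pstarE); apply/pclassE/SStarZ.
Qed.
Let pstarM (x y : presented) : pstar (x * y) = pstar y * pstar x.
Proof.
rewrite -(preprK x) -(preprK y) -[LHS]/(pstar (mul _ _)).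
by rewrite -[RHS]/(mul _ _) !(mulE, pstarE); apply/pclassE/SStarM.
Qed.
Let pstarK (x : presented) : pstar (pstar x) = x.
Proof. by rewrite -(preprK x) !pstarE; apply/pclassE/SStarK. Qed.

HB.instance Definition _ := hasStar.Build C presented
  pstarD pstarZ pstarM pstarK.

Lemma pclassD s t : pclass (s + t) = (pclass s + pclass t)%R.
Proof. by rewrite -addE. Qed.
Lemma pclassN s : pclass (- s) = (- pclass s)%R.
Proof. by rewrite -oppE. Qed.
Lemma pclassZ a s : pclass (a *: s) = (a *: pclass s)%R.
Proof. by rewrite -scaleE. Qed.
Lemma pclassM s t : pclass (s * t) = (pclass s * pclass t)%R.
Proof. by rewrite -mulE. Qed.
Lemma pclass_star s : pclass (s^*) = star (pclass s).
Proof. by rewrite -pstarE. Qed.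

Definition generator (x : pgen P) : presented := pclass (TVar x).

Lemma seval_generator s : seval generator s = pclass s.
Proof.
elim: s => //= [s -> t ->|s ->|a s ->|s -> t ->|s ->].
- by rewrite pclassD.
- by rewrite pclassN.
- by rewrite pclassZ.
- by rewrite pclassM.
- by rewrite pclass_star.
Qed.

Lemma generatorP : satisfies (@prels C P) generator.
Proof. by move=> s t st; rewrite !seval_generator; apply/pclassE/SRel. Qed.

Section Lift.
Variables (A : starAlgType C) (v : pgen P -> A).
Hypothesis hv : satisfies (@prels C P) v.

Definition lift of satisfies (@prels C P) v : presented -> A :=
  fun x => seval v (prepr x).

Lemma lift_pclass s : lift hv (pclass s) = seval v s.
Proof. exact: scong_eval hv (pclassK s). Qed.

Lemma lift_generator x : lift hv (generator x) = v x.
Proof. exact: lift_pclass. Qed.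

Let liftD : {morph lift hv : x y / x + y}.
Proof.
by move=> x y; rewrite -(preprK x) -(preprK y) -pclassD !lift_pclass.
Qed.
Let lift0 : lift hv 0 = 0.
Proof. exact: (lift_pclass 0%stm). Qed.
HB.instance Definition _ := GRing.isNmodMorphism.Build presented A (lift hv)
  (conj lift0 liftD).

Let liftM : {morph lift hv : x y / x * y}.
Proof.
by move=> x y; rewrite -(preprK x) -(preprK y) -pclassM !lift_pclass.
Qed.
Let lift1 : lift hv 1 = 1.
Proof. exact: (lift_pclass 1%stm). Qed.
HB.instance Definition _ := GRing.isMonoidMorphism.Build presented A (lift hv)
  (conj lift1 liftM).

Let liftZ : scalable (lift hv).
Proof. by move=> a x; rewrite -(preprK x) -pclassZ !lift_pclass. Qed.
HB.instance Definition _ := GRing.isScalable.Build C presented A *:%R (lift hv)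
  liftZ.

Lemma lift_star : star_preserving (lift hv).
Proof. by move=> x; rewrite -(preprK x) -pclass_star !lift_pclass. Qed.

Lemma lift_unique (f : {lrmorphism presented -> A}) :
  star_preserving f -> (forall x, f (generator x) = v x) -> f =1 lift hv.
Proof.
move=> fs fv x; rewrite -(preprK x) lift_pclass.
elim: (prepr x) => //= [||s IHs t IHt|s IHs|a s IHs|s IHs t IHt|s IHs].
- exact: rmorph0.
- exact: rmorph1.
- by rewrite pclassD raddfD /= IHs IHt.
- by rewrite pclassN raddfN /= IHs.
- by rewrite pclassZ linearZ /= IHs.
- by rewrite pclassM rmorphM /= IHs IHt.
- by rewrite pclass_star fs IHs.
Qed.

End Lift.

End Presented.

Section QuantumSpheres.
Variable R : realType.

Definition disc_rels (r : R) : set (sterm R[i] unit * sterm R[i] unit) :=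
  let z := TVar tt in
  [set ((z^* * z - r%:C *: (z * z^*))%stm, ((1 - r)%:C *: 1)%stm)]%classic.

Definition circle_rels : set (sterm R[i] unit * sterm R[i] unit) :=
  let u := TVar tt in
  [set ((u^* * u)%stm, 1%stm); ((u * u^*)%stm, 1%stm)]%classic.

Inductive podles_gen := PodlesA | PodlesB.

Definition podles_rels (mu c : R) :
    set (sterm R[i] podles_gen * sterm R[i] podles_gen) :=
  let A := TVar PodlesA in let B := TVar PodlesB in
  [set (A, A^*%stm);
       ((B * A)%stm, ((mu ^+ 2)%:C *: (A * B))%stm);
       ((B^* * B)%stm, (A - A * A + c%:C *: 1)%stm);
       ((B * B^*)%stm,
        ((mu ^+ 2)%:C *: A - (mu ^+ 4)%:C *: (A * A) + c%:C *: 1)%stm)]%classic.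

Lemma disc_satisfies (A : starAlgType R[i]) (r : R) (z : A) :
  satisfies (disc_rels r) (fun=> z) <->
  star z * z - r%:C *: (z * star z) = (1 - r)%:C *: 1.
Proof. by split=> [h|h s t [-> ->]] //; exact: h erefl. Qed.

Lemma circle_satisfies (A : starAlgType R[i]) (u : A) :
  satisfies circle_rels (fun=> u) <-> star u * u = 1 /\ u * star u = 1.
Proof.
split=> [h|[h1 h2] s t [[-> ->]|[-> ->]] //].
by split; [exact: h (or_introl erefl)|exact: h (or_intror erefl)].
Qed.

Lemma podles_satisfies (A : starAlgType R[i]) (mu c : R) (a b : A) :
  satisfies (podles_rels mu c) (fun g => if g is PodlesA then a else b) <->
  [/\ a = star a, b * a = (mu ^+ 2)%:C *: (a * b),
      star b * b = a - a * a + c%:C *: 1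
    & b * star b = (mu ^+ 2)%:C *: a - (mu ^+ 4)%:C *: (a * a) + c%:C *: 1].
Proof.
split=> [h|[h1 h2 h3 h4] s t [[[[-> ->]|[-> ->]]|[-> ->]]|[-> ->]] //].
split; [exact: h (or_introl (or_introl (or_introl erefl)))
  | exact: h (or_introl (or_introl (or_intror erefl)))
  | exact: h (or_introl (or_intror erefl)) | exact: h (or_intror erefl)].
Qed.

Lemma disc_model (r : R) :
  exists v : unit -> R[i]^o, satisfies (disc_rels r) v.
Proof.
exists (fun=> 1); apply/disc_satisfies.
by rewrite star1 mulr1 rmorphB scalerBl scale1r.
Qed.

Lemma circle_model : exists v : unit -> R[i]^o, satisfies circle_rels v.
Proof. by exists (fun=> 1); apply/circle_satisfies; rewrite star1 mulr1. Qed.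

Lemma podles_model (mu c : R) : 0 < c ->
  exists v : podles_gen -> R[i]^o, satisfies (podles_rels mu c) v.
Proof.
move=> c0.
exists (fun g => if g is PodlesB then (Num.sqrt c)%:C else 0).
have sE : star ((Num.sqrt c)%:C : R[i]^o) = (Num.sqrt c)%:C by exact: conjc_real.
have s2 : (Num.sqrt c)%:C * (Num.sqrt c)%:C = c%:C :> R[i].
  by rewrite -rmorphM -expr2 sqr_sqrtr // ltW.
move=> s t [[[[-> ->]|[-> ->]]|[-> ->]]|[-> ->]] /=.
- by rewrite star0.
- by rewrite mulr0 mul0r scaler0.
- rewrite sE mulr0 subr0 add0r; apply: etrans s2 _; exact/esym/mulr1.
- rewrite sE mulr0 !scaler0 subr0 add0r; apply: etrans s2 _; exact/esym/mulr1.
Qed.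

Definition disc (r : R) : starAlgType R[i] :=
  presented (Presentation (disc_model r)).

Definition circle : starAlgType R[i] := presented (Presentation circle_model).

(* The hypothesis 0 < c only serves to show that the algebra is nonzero. *)
Definition podles_sphere (mu c : R) (c0 : 0 < c) : starAlgType R[i] :=
  presented (Presentation (podles_model mu c0)).

Definition disc_z (r : R) : disc r :=
  @generator _ (Presentation (disc_model r)) tt.
Definition circle_u : circle := @generator _ (Presentation circle_model) tt.

Lemma boundary_subproof (r : R) : satisfies (disc_rels r) (fun=> circle_u).
Proof.
have /circle_satisfies[h1 h2] : satisfies circle_rels (fun=> circle_u).
  move=> s t /(@generatorP _ (Presentation circle_model)) /=.
  by congr (_ = _); congr seval; apply: funext => -[].
by apply/disc_satisfies; rewrite h1 h2 rmorphB scalerBl scale1r.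
Qed.

Definition boundary (r : R) : {lrmorphism disc r -> circle} :=
  @lift _ (Presentation (disc_model r)) circle _ (@boundary_subproof r).

Lemma boundary_z (r : R) : boundary r (disc_z r) = circle_u.
Proof. exact: lift_generator. Qed.

Lemma boundary_star (r : R) : star_preserving (boundary r).
Proof. exact: lift_star. Qed.

Definition glued (p q : R) : {pred disc p * disc q} :=
  [pred x | boundary p x.1 == boundary q x.2].

Arguments glued : clear implicits.

Lemma gluedP (p q : R) (x : disc p * disc q) :
  reflect (boundary p x.1 = boundary q x.2) (x \in glued p q).
Proof. exact: eqP. Qed.

Lemma glued_subalg (p q : R) : subalg_closed (glued p q).
Proof.
split=> [|a x y /gluedP hx /gluedP hy|x y /gluedP hx /gluedP hy];
  apply/gluedP => /=.
- by rewrite !rmorph1.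
- by rewrite !linearP /= hx hy.
- by rewrite !rmorphM /= hx hy.
Qed.

Definition quantum_sphere_sort (p q : R) : Type :=
  {x : disc p * disc q | x \in glued p q}.

Section QuantumSphere.
Variables p q : R.
Local Notation S2 := (quantum_sphere_sort p q).

HB.instance Definition _ := SubChoice.on S2.
HB.instance Definition _ := GRing.isSubalgClosed.Build _ _ (glued p q)
  (GRing.subalg_closed_semi (@glued_subalg p q)).
HB.instance Definition _ := [SubChoice_isSubAlgebra of S2 by <:].

Let gluedS (x : disc p * disc q) : x \in glued p q -> star x \in glued p q.
Proof. by move=> /gluedP h; apply/gluedP; rewrite /= !boundary_star h. Qed.

Let sstar (x : S2) : S2 := Sub (star (val x)) (gluedS (valP x)).
Let sstarD (x y : S2) : sstar (x + y) = sstar x + sstar y.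
Proof. by apply: val_inj; rewrite /= starD. Qed.
Let sstarZ (a : R[i]) (x : S2) : sstar (a *: x) = Num.conj a *: sstar x.
Proof. by apply: val_inj; rewrite /= starZ. Qed.
Let sstarM (x y : S2) : sstar (x * y) = sstar y * sstar x.
Proof. by apply: val_inj; rewrite /= starM. Qed.
Let sstarK (x : S2) : sstar (sstar x) = x.
Proof. by apply: val_inj; rewrite /= starK. Qed.
HB.instance Definition _ := hasStar.Build R[i] S2 sstarD sstarZ sstarM sstarK.

End QuantumSphere.

Definition quantum_sphere (p q : R) : starAlgType R[i] :=
  quantum_sphere_sort p q.

End QuantumSpheres.

(* Main.v *)
Require Import Defs.
From mathcomp Require Import all_boot all_order all_algebra complex reals.
From HB Require Import structures.
From mathcomp Require Import boolp ring.

Import Order.TTheory GRing.Theory Num.Theory.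
Local Open Scope ring_scope.
Local Open Scope complex_scope.

(* In the Podles algebra U the element A is normal (AU = UA) and U / AU is
   commutative, so A divides every commutator; moreover every character of U
   kills A. In O(S^2_pq) the commutators [f_0, f_1] = (_, 0) and
   [g_0, f_1] = (0, _), where f_0 = (xx^*, 1) and g_0 = (1, yy^* ), are not
   both divisible by one element a killed by all characters. Indeed O(D_p) and
   O(D_q) have upper triangular 2x2 representations rho_p, rho_q with the same
   lower right character chi, in which these commutators are nonzero strictly
   upper triangular. If [f_0, f_1] = a s and [g_0, f_1] = a t, then the (0, 1)
   entry of rho (a s) is rho(a)_01 chi(s). It is nonzero for rho_p, so
   chi(s) <> 0, and zero for rho_q, so rho_q(a)_01 = 0; but then the (0, 1)
   entry of rho_q [g_0, f_1] = rho_q (a t) vanishes, a contradiction. *)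

(** * Induction on the elements of a presented star-algebra *)

Lemma presented_ind (C : numClosedFieldType) (P : presentation C)
    (K : presented P -> Prop) :
  (forall g, K (generator g)) -> K 1 ->
  (forall (a : C) x y, K x -> K y -> K (a *: x + y)) ->
  (forall x y, K x -> K y -> K (x * y)) ->
  (forall x, K x -> K (star x)) ->
  forall x, K x.
Proof.
move=> Kg K1 KL KM KS x; rewrite -(preprK x).
have K0 : K 0 by rewrite -(addNr 1) -scaleN1r; exact: KL.
have KZ a y : K y -> K (a *: y) by move=> Ky; rewrite -[_ *: y]addr0; exact: KL.
elim: (prepr x) => [g|||s Ks t Kt|s Ks|a s Ks|s Ks t Kt|s Ks].
- exact: Kg.
- exact: K0.
- exact: K1.
- by rewrite pclassD -[pclass s]scale1r; exact: KL.
- by rewrite pclassN -scaleN1r; exact: KZ.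
- by rewrite pclassZ; exact: KZ.
- by rewrite pclassM; exact: KM.
- by rewrite pclass_star; exact: KS.
Qed.

(* The involution exchanges the two factors, so that mapping into mxdouble
   amounts to representing z and z^* by two unrelated matrices: the
   representations needed here are not *-representations. *)
Definition mxdouble (C : numClosedFieldType) (n : nat) : Type :=
  ('M[C]_n.+1 * 'M[C]_n.+1)%type.

(** * Pairs of matrices as a star-algebra *)

Section MxDouble.
Variables (C : numClosedFieldType) (n : nat).
Local Notation D := (mxdouble C n).

HB.instance Definition _ := GRing.Algebra.on D.

Definition adjmx (X : 'M[C]_n.+1) : 'M[C]_n.+1 := (map_mx Num.conj X)^T.

Lemma adjmxE (X : 'M[C]_n.+1) i j : adjmx X i j = Num.conj (X j i).
Proof. by rewrite !mxE. Qed.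

Let dstar (x : D) : D := (adjmx x.2, adjmx x.1).

Lemma adjmxD X Y : adjmx (X + Y) = adjmx X + adjmx Y.
Proof. by rewrite /adjmx map_mxD linearD. Qed.
Lemma adjmxZ a X : adjmx (a *: X) = Num.conj a *: adjmx X.
Proof. by rewrite /adjmx map_mxZ linearZ. Qed.
Lemma adjmxM X Y : adjmx (X * Y) = adjmx Y * adjmx X.
Proof. by rewrite /adjmx map_mxM trmx_mul. Qed.
Lemma adjmxK X : adjmx (adjmx X) = X.
Proof. by apply/matrixP => i j; rewrite !adjmxE conjCK. Qed.

Let dstarD (x y : D) : dstar (x + y) = dstar x + dstar y.
Proof. by rewrite /dstar !adjmxD. Qed.
Let dstarZ (a : C) (x : D) : dstar (a *: x) = Num.conj a *: dstar x.
Proof. by rewrite /dstar !adjmxZ. Qed.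
Let dstarM (x y : D) : dstar (x * y) = dstar y * dstar x.
Proof. by rewrite /dstar !adjmxM. Qed.
Let dstarK (x : D) : dstar (dstar x) = x.
Proof. by case: x => X Y; rewrite /dstar /= !adjmxK. Qed.

HB.instance Definition _ := hasStar.Build C D dstarD dstarZ dstarM dstarK.

Lemma mxdouble_starE (x : D) : star x = (adjmx x.2, adjmx x.1).
Proof. by []. Qed.

End MxDouble.
Arguments adjmx {C n}.

Lemma mx2P (S : Type) (X Y : 'M[S]_2) :
  X 0 0 = Y 0 0 -> X 0 1 = Y 0 1 -> X 1 0 = Y 1 0 -> X 1 1 = Y 1 1 -> X = Y.
Proof.
have ordP (i : 'I_2) : i = 0 \/ i = 1.
  by case: i => [[|[|]] // ?]; [left|right]; apply: val_inj.
by move=> *; apply/matrixP => i j; case: (ordP i) => ->; case: (ordP j) => ->.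
Qed.

Lemma mulmx2E (S : nzRingType) (X Y : 'M[S]_2) i j :
  (X * Y) i j = X i 0 * Y 0 j + X i 1 * Y 1 j.
Proof. by rewrite mxE !big_ord_recl big_ord0 addr0; do 4 f_equal; apply: val_inj. Qed.

(** * The character of the circle at u = 1 *)

Section CircleEvaluation.
Variable R : realType.

Lemma circle_ev_satisfies : satisfies (@circle_rels R) (fun=> 1 : R[i]^o).
Proof. by apply/circle_satisfies; rewrite star1 mulr1. Qed.

Definition circle_ev : {lrmorphism circle R -> R[i]^o} :=
  @Defs.lift _ (Presentation (circle_model R)) _ _ circle_ev_satisfies.

Lemma circle_ev_u : circle_ev (circle_u R) = 1.
Proof. exact: lift_generator. Qed.

Lemma circle_ev_star x : circle_ev (star x) = Num.conj (circle_ev x : R[i]).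
Proof. exact: lift_star. Qed.

End CircleEvaluation.

(** * Triangular representations of the disc algebra *)

Section DiscRepresentation.
Variables (R : realType) (r : R).
Hypothesis r01 : 0 < r < 1.
Local Notation C := R[i].

Definition upmx (a b d : C) : 'M[C]_2 :=
  \matrix_(i, j) (if i == 0 then if j == 0 then a else b
                  else if j == 0 then 0 else d).

Lemma upmxM a b d a' b' d' :
  upmx a b d * upmx a' b' d' = upmx (a * a') (a * b' + b * d') (d * d').
Proof. by apply: mx2P; rewrite mulmx2E !mxE /=; ring. Qed.

(** The diagonals of [zmx] and [zsmx] are inverse to each other, which is the disc relation on the
    diagonal. If [zmx] is diag(l, 1) and [zsmx] has (0, 1) entry b, the (0, 1) entry of the relation
    is b - r l b = 0, so a nonzero b forces l = 1/r; b = -r is a normalisation. *)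
Definition zmx : 'M[C]_2 := upmx (r%:C^-1) 0 1.
Definition zsmx : 'M[C]_2 := upmx r%:C (- r%:C) 1.

Lemma rC_neq0 : r%:C != 0 :> C.
Proof. by case/andP: r01 => /lt0r_neq0 r0 _; rewrite (fmorph_eq0 (real_complex R)). Qed.

Lemma zmx_rel : zsmx * zmx - r%:C *: (zmx * zsmx) = (1 - r)%:C *: 1.
Proof.
have -> : (1 - r)%:C = 1 - r%:C :> C by rewrite rmorphB rmorph1.
have rC := rC_neq0.
by rewrite !upmxM; apply: mx2P; rewrite !mxE /=; field.
Qed.

Definition zdouble : mxdouble C 1 := (zmx, adjmx zsmx).

Lemma zdouble_satisfies : satisfies (disc_rels r) (fun=> zdouble).
Proof.
apply/disc_satisfies; rewrite mxdouble_starE /= adjmxK.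
congr pair; first exact: zmx_rel.
have adj1 : adjmx (1 : 'M[C]_2) = 1.
  by rewrite -[LHS]mulr1 -{2}[1]adjmxK -adjmxM mulr1 adjmxK.
have conjr (s : R) : Num.conj s%:C = s%:C by exact: conjc_real.
(* The second component of the relation is the adjoint of the first, as r is real. *)
have := congr1 adjmx zmx_rel.
rewrite -scaleNr -rmorphN adjmxD !adjmxZ !adjmxM adj1 !conjr rmorphN scaleNr.
exact.
Qed.

Definition disc_lift : {lrmorphism disc r -> mxdouble C 1} :=
  @Defs.lift _ (Presentation (disc_model r)) _ _ zdouble_satisfies.

Definition disc_rep (x : disc r) : 'M[C]_2 := (disc_lift x).1.

Let disc_rep_nmod : nmod_morphism disc_rep.
Proof. by split=> [|x y]; rewrite /disc_rep ?raddf0 ?raddfD. Qed.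
HB.instance Definition _ :=
  GRing.isNmodMorphism.Build (disc r) 'M[C]_2 disc_rep disc_rep_nmod.

Let disc_rep_monoid : monoid_morphism disc_rep.
Proof. by split=> [|x y]; rewrite /disc_rep ?rmorph1 ?rmorphM. Qed.
HB.instance Definition _ :=
  GRing.isMonoidMorphism.Build (disc r) 'M[C]_2 disc_rep disc_rep_monoid.

Let disc_rep_scalable : scalable disc_rep.
Proof. by move=> a x; rewrite /disc_rep linearZ. Qed.
HB.instance Definition _ :=
  GRing.isScalable.Build C (disc r) 'M[C]_2 *:%R disc_rep disc_rep_scalable.

Lemma disc_lift_z : disc_lift (disc_z r) = zdouble.
Proof. exact: lift_generator. Qed.

Lemma disc_lift_star x : disc_lift (star x) = star (disc_lift x).
Proof. exact: lift_star. Qed.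

Lemma disc_rep_z : disc_rep (disc_z r) = zmx.
Proof. by rewrite /disc_rep disc_lift_z. Qed.

Lemma disc_rep_star_z : disc_rep (star (disc_z r)) = zsmx.
Proof. by rewrite /disc_rep disc_lift_star disc_lift_z mxdouble_starE /= adjmxK. Qed.

Lemma disc_rep_comm :
  let z := disc_z r in
  disc_rep (z * star z * z - z * (z * star z)) = upmx 0 (r%:C^-1 - 1) 0.
Proof.
move=> z; have rC := rC_neq0.
rewrite rmorphB !rmorphM /= disc_rep_z disc_rep_star_z !upmxM.
by apply: mx2P; rewrite !mxE /=; field.
Qed.

(** [star] swaps the two components and transposes them, so the induction has to carry an upper
    triangular first component and a lower triangular second one together. Both lower right entries
    are the character z -> 1, which factors through the boundary circle. *)
Lemma disc_lift_tri (x : disc r) :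
  [/\ (disc_lift x).1 1 0 = 0, (disc_lift x).2 0 1 = 0,
      (disc_lift x).1 1 1 = circle_ev _ (boundary r x)
    & (disc_lift x).2 1 1 = circle_ev _ (boundary r x)].
Proof.
elim/presented_ind: x => [[]||a x y [x1 x2 x3 x4] [y1 y2 y3 y4]|x y|x [x1 x2 x3 x4]].
- rewrite -/(disc_z r) disc_lift_z boundary_z circle_ev_u /= adjmxE !mxE /=.
  by rewrite conjC0 conjC1.
- by rewrite !rmorph1 !mxE.
- rewrite !linearP /= !mxE x1 x2 x3 x4 y1 y2 y3 y4.
  by rewrite !mulr0 addr0.
- move=> [x1 x2 x3 x4] [y1 y2 y3 y4].
  rewrite !rmorphM /= !mulmx2E x1 x2 x3 x4 y1 y2 y3 y4.
  by rewrite !(mulr0, mul0r, addr0, add0r).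
- rewrite disc_lift_star mxdouble_starE boundary_star circle_ev_star !adjmxE.
  by rewrite x1 x2 x3 x4 conjC0.
Qed.

Lemma disc_rep_tri x : disc_rep x 1 0 = 0.
Proof. by case: (disc_lift_tri x). Qed.

Lemma disc_rep_boundary x : disc_rep x 1 1 = circle_ev _ (boundary r x).
Proof. by case: (disc_lift_tri x). Qed.

End DiscRepresentation.
Arguments disc_rep {R r}.

(** * Divisibility of commutators in the Podleś algebra *)

Section PodlesCommutators.
Variables (R : realType) (mu c : R).
Hypotheses (mu0 : mu != 0) (c0 : 0 < c).
Local Notation U := (podles_sphere mu c0).
Local Notation m := ((mu ^+ 2)%:C : R[i]).

Definition podles_A : U := @generator _ (Presentation (podles_model mu c0)) PodlesA.
Definition podles_B : U := @generator _ (Presentation (podles_model mu c0)) PodlesB.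

Lemma podles_relations :
  [/\ podles_A = star podles_A,
      podles_B * podles_A = m *: (podles_A * podles_B),
      star podles_B * podles_B = podles_A - podles_A * podles_A + c%:C *: 1
    & podles_B * star podles_B =
        m *: podles_A - (mu ^+ 4)%:C *: (podles_A * podles_A) + c%:C *: 1].
Proof.
apply/podles_satisfies => s t /(@generatorP _ (Presentation (podles_model mu c0))) /=.
by congr (_ = _); congr seval; apply: funext => -[].
Qed.

Definition in_ideal_A (x : U) := exists u, x = podles_A * u.

Let I0 : in_ideal_A 0. Proof. by exists 0; rewrite mulr0. Qed.
Let IL a x y : in_ideal_A x -> in_ideal_A y -> in_ideal_A (a *: x + y).
Proof. by case=> u -> [v ->]; exists (a *: u + v); rewrite mulrDr scalerAr. Qed.
Let ID x y : in_ideal_A x -> in_ideal_A y -> in_ideal_A (x + y).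
Proof. by rewrite -{2}[x]scale1r; exact: IL. Qed.
Let IMr x y : in_ideal_A x -> in_ideal_A (x * y).
Proof. by case=> u ->; exists (u * y); rewrite mulrA. Qed.

(** On [podles_B] both halves come from B A = mu^2 A B, as mu^2 is invertible. They are proved
    together because [star] fixes A and exchanges them. Hence the right ideal generated by A is
    two-sided. *)
Lemma podles_A_normal x :
  (exists u, x * podles_A = podles_A * u) /\ (exists u, podles_A * x = u * podles_A).
Proof.
have [A1 A2 _ _] := podles_relations.
have m0 : m != 0 by rewrite (fmorph_eq0 (real_complex R)) expf_neq0.
elim/presented_ind: x => [[]||a x y|x y|x].
- by split; exists podles_A.
- split; first by exists (m *: podles_B); rewrite A2 scalerAr.
  by exists (m^-1 *: podles_B); rewrite -scalerAl A2 scalerA mulVf ?scale1r.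
- by split; exists 1; rewrite mulr1 mul1r.
- move=> [[u hu] [v hv]] [[u' hu'] [v' hv']]; split.
    by exists (a *: u + u'); rewrite mulrDl mulrDr -scalerAl -scalerAr hu hu'.
  by exists (a *: v + v'); rewrite mulrDl mulrDr -scalerAl -scalerAr hv hv'.
- move=> [[u hu] [v hv]] [[u' hu'] [v' hv']]; split.
    by exists (u * u'); rewrite -mulrA hu' mulrA hu mulrA.
  by exists (v * v'); rewrite mulrA hv -mulrA hv' mulrA.
- move=> [[u hu] [v hv]]; split.
    by exists (star v); have := congr1 star hv; rewrite !starM -A1.
  by exists (star u); have := congr1 star hu; rewrite !starM -A1.
Qed.

Let IMl x y : in_ideal_A y -> in_ideal_A (x * y).
Proof.
case=> u ->; have [[v hv] _] := podles_A_normal x.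
by exists (v * u); rewrite mulrA hv mulrA.
Qed.

Let IS x : in_ideal_A x -> in_ideal_A (star x).
Proof.
have [A1 _ _ _] := podles_relations.
case=> u ->; rewrite starM -A1; have [[v hv] _] := podles_A_normal (star u).
by exists v.
Qed.

Local Notation comm x y := (x * y - y * x).

Let comm1 x : comm x 1 = 0 :> U. Proof. by rewrite mulr1 mul1r subrr. Qed.
Let commL x a y z : comm x (a *: y + z) = a *: comm x y + comm x z :> U.
Proof.
by rewrite mulrDl mulrDr -scalerAl -scalerAr scalerBr opprD addrACA.
Qed.
Let commM x y z : comm x (y * z) = comm x y * z + y * comm x z :> U.
Proof. by rewrite mulrBl mulrBr !mulrA addrA subrK. Qed.
Let commS x y : comm (star x) (star y) = star (comm y x) :> U.
Proof. by rewrite starB !starM. Qed.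

(** Modulo A both B^* B and B B^* reduce to c, so B and B^* commute there. Linearity, the Leibniz
    rule [commM] and [commS] extend this to all elements, one argument at a time. *)
Lemma podles_comm_ideal x y : in_ideal_A (comm x y).
Proof.
have [A1 A2 A3 A4] := podles_relations.
have IN z : in_ideal_A z -> in_ideal_A (- z).
  by move=> h; rewrite -[- z]addr0 -scaleN1r; exact: IL.
have IC x' y' : in_ideal_A (comm x' y') -> in_ideal_A (comm y' x').
  by move=> /IN; rewrite opprB.
have IA z : in_ideal_A (comm podles_A z).
  have [[u hu] _] := podles_A_normal z.
  by exists (z - u); rewrite mulrBr hu.
have IBS : in_ideal_A (comm podles_B (star podles_B)).
  rewrite A3 A4 opprD addrACA subrr addr0.
  (* Once c has cancelled, mu^2 A - mu^4 A^2 - (A - A^2) remains; the witness is its quotient by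
     A. *)
  exists (m *: 1 - (mu ^+ 4)%:C *: podles_A - (1 - podles_A)).
  by rewrite !mulrBr -!scalerAr !mulr1.
(* B and [star] B go together: passing from z to [star] z trades one for the other. *)
have IB z : in_ideal_A (comm podles_B z) /\ in_ideal_A (comm (star podles_B) z).
  elim/presented_ind: z => [[]||a z t|z t|z].
  - by split; apply/IC; exact: IA.
  - by split; [rewrite subrr|exact: IC].
  - by rewrite !comm1.
  - by move=> [z1 z2] [t1 t2]; rewrite !commL; split; exact: IL.
  - move=> [z1 z2] [t1 t2]; rewrite !commM.
    by split; apply: ID; [exact: IMr|exact: IMl|exact: IMr|exact: IMl].
  - move=> [z1 z2]; split; last by rewrite commS; apply/IS/IC.
    by rewrite -[podles_B]starK commS; apply/IS/IC.
have {}IB z : in_ideal_A (comm podles_B z) by case: (IB z).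
elim/presented_ind: x y => [[]||a x z Hx Hz|x z Hx Hz|x Hx] y //.
- by apply/IC; rewrite comm1.
- by apply/IC; rewrite commL; apply: IL; exact: IC.
- apply/IC; rewrite commM.
  by apply: ID; [apply/IMr/IC|apply/IMl/IC].
(* The induction hypothesis holds for every second argument and is used at [star y]. *)
- by rewrite -[y]starK commS; apply/IS/IC.
Qed.

End PodlesCommutators.
Arguments podles_A {R mu c}.
Arguments podles_B {R mu c}.
Arguments podles_relations {R} mu {c}.
Arguments podles_comm_ideal {R mu c}.

(** * Characters annihilate A *)

Section Character.
Variables (R : realType) (mu c : R).
Hypotheses (mu01 : 0 < mu < 1) (c0 : 0 < c).
Local Notation C := R[i].

(* If a <> 0 then b = 0, and subtracting the last two relations forces
   a = 1 / (1 + mu^2), where a - a^2 + c > 0. *)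
Lemma podles_character (a b b' : C) :
  b * a = (mu ^+ 2)%:C * (a * b) ->
  b' * b = a - a * a + c%:C ->
  b * b' = (mu ^+ 2)%:C * a - (mu ^+ 4)%:C * (a * a) + c%:C ->
  a = 0.
Proof.
rewrite (_ : mu ^+ 4 = mu ^+ 2 * mu ^+ 2); last by rewrite -exprD.
have /andP[mu0 mu1] := mu01.
have k0 : 0 < mu ^+ 2 by rewrite exprn_gt0.
have k1 : mu ^+ 2 < 1 by rewrite exprn_ilt1 // ltW.
move: (mu ^+ 2) k0 k1 => k k0 k1 h1 h3 h4.
have [//|a0] := eqVneq a 0.
have kC : 1 - k%:C != 0 :> C.
  rewrite -(rmorph1 (real_complex R)) -rmorphB (fmorph_eq0 (real_complex R)).
  by rewrite subr_eq0 gt_eqF.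
have b0 : b = 0.
  apply/eqP; have /eqP : (1 - k%:C) * a * b = 0.
    by rewrite !mulrBl mul1r -mulrA -h1 mulrC subrr.
  by rewrite !mulf_eq0 (negPf kC) (negPf a0).
move: h3 h4; rewrite b0 mulr0 mul0r rmorphM => /esym h3 /esym h4.
(* The left sides of [h4] and [h3] differ by (1 - k) a ((1 + k) a - 1). *)
have h5 : a * (1 + k%:C) = 1.
  apply: (mulfI a0); apply: (mulfI kC).
  apply/eqP; rewrite -subr_eq0; apply/eqP.
  have -> : 0 = (k%:C * a - k%:C * k%:C * (a * a) + c%:C) - (a - a * a + c%:C) :> C.
    by rewrite h3 h4 subrr.
  by ring.
(* Multiplying [h3] by (1 + k)^2 and substituting [h5] leaves a positive real number equal to 0. *)
have : (k + c * (1 + k) ^+ 2)%:C = 0 :> C.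
  rewrite rmorphD rmorphM rmorphXn rmorphD rmorph1 /=.
  rewrite -[RHS](mulr0 ((1 + k%:C) ^+ 2)) -h3.
  have -> : (1 + k%:C) ^+ 2 * (a - a * a + c%:C) =
      (1 + k%:C) * (a * (1 + k%:C)) - (a * (1 + k%:C)) ^+ 2
      + c%:C * (1 + k%:C) ^+ 2 by ring.
  by rewrite h5; ring.
move/eqP; rewrite (fmorph_eq0 (real_complex R)) gt_eqF //.
by rewrite addr_gt0 // mulr_gt0 // exprn_gt0 // addr_gt0.
Qed.

(** The (0, 0) entry of an upper triangular product is the product of the (0, 0) entries, so
    composing with [g] gives a character of the Podleś algebra. [podles_character] applies, with its
    value at [star] B as [b']. *)
Lemma tri_rep_podles_A (E : starAlgType C)
    (f : {lrmorphism E -> podles_sphere mu c0}) g (rho : {lrmorphism E -> 'M[C]_2}) :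
  cancel f g -> cancel g f -> (forall x, rho x 1 0 = 0) ->
  rho (g (podles_A c0)) 0 0 = 0.
Proof.
move=> fK gK tri.
have [_ A2 A3 A4] := podles_relations mu c0.
have chiM x y : rho (x * y) 0 0 = rho x 0 0 * rho y 0 0.
  by rewrite rmorphM mulmx2E tri mulr0 addr0.
(* [g] is only a function inverse to [f]; the algebra laws pass to it through the injectivity of
   [f]. *)
have gM x y : g (x * y) = g x * g y.
  by apply: (can_inj fK); rewrite rmorphM /= !gK.
have gZ a x : g (a *: x) = a *: g x.
  by apply: (can_inj fK); rewrite linearZ /= !gK.
have gD x y : g (x + y) = g x + g y.
  by apply: (can_inj fK); rewrite raddfD /= !gK.
have gN x : g (- x) = - g x.
  by apply: (can_inj fK); rewrite raddfN /= !gK.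
have g1 : g 1 = 1.
  by apply: (can_inj fK); rewrite rmorph1 !gK.
pose chi x := rho (g x) 0 0.
have cM x y : chi (x * y) = chi x * chi y by rewrite /chi gM chiM.
have cZ a x : chi (a *: x) = a * chi x by rewrite /chi gZ linearZ mxE.
have cD x y : chi (x + y) = chi x + chi y by rewrite /chi gD raddfD mxE.
have cN x : chi (- x) = - chi x by rewrite /chi gN raddfN mxE.
have c1 : chi 1 = 1 by rewrite /chi g1 rmorph1 mxE.
apply: (@podles_character (chi (podles_A c0)) (chi (podles_B c0))
  (chi (star (podles_B c0)))).
- by rewrite -!cM A2 cZ.
- by rewrite -!cM A3 !(cD, cN, cZ, c1) mulr1.
- by rewrite -!cM A4 !(cD, cN, cZ, c1, cM) mulr1.
Qed.

End Character.

(** * Elements of the glued algebra and their commutators *)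

Section SphereGenerators.
Variables (R : realType) (p q : R).
Local Notation x := (disc_z p).
Local Notation y := (disc_z q).
Local Notation S2 := (quantum_sphere p q).

Definition sphere_fst (s : S2) : disc p := (val s).1.

Let sphere_fst_nmod : nmod_morphism sphere_fst. Proof. by []. Qed.
HB.instance Definition _ :=
  GRing.isNmodMorphism.Build S2 (disc p) sphere_fst sphere_fst_nmod.
Let sphere_fst_monoid : monoid_morphism sphere_fst. Proof. by []. Qed.
HB.instance Definition _ :=
  GRing.isMonoidMorphism.Build S2 (disc p) sphere_fst sphere_fst_monoid.
Let sphere_fst_scalable : scalable sphere_fst. Proof. by []. Qed.
HB.instance Definition _ :=
  GRing.isScalable.Build R[i] S2 (disc p) *:%R sphere_fst sphere_fst_scalable.

Definition sphere_snd (s : S2) : disc q := (val s).2.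

Let sphere_snd_nmod : nmod_morphism sphere_snd. Proof. by []. Qed.
HB.instance Definition _ :=
  GRing.isNmodMorphism.Build S2 (disc q) sphere_snd sphere_snd_nmod.
Let sphere_snd_monoid : monoid_morphism sphere_snd. Proof. by []. Qed.
HB.instance Definition _ :=
  GRing.isMonoidMorphism.Build S2 (disc q) sphere_snd sphere_snd_monoid.
Let sphere_snd_scalable : scalable sphere_snd. Proof. by []. Qed.
HB.instance Definition _ :=
  GRing.isScalable.Build R[i] S2 (disc q) *:%R sphere_snd sphere_snd_scalable.

Lemma boundary_sphere (s : S2) :
  boundary p (sphere_fst s) = boundary q (sphere_snd s).
Proof. exact/gluedP/valP. Qed.

(** The image is u u^* = 1, so [z * star z] in one disc glues with 1 in the other. *)
Lemma boundary_norm (r : R) : boundary r (disc_z r * star (disc_z r)) = 1.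
Proof.
have /circle_satisfies[_ uu] : satisfies (@circle_rels R) (fun=> circle_u R).
  move=> s t /(@generatorP _ (Presentation (circle_model R))) /=.
  by congr (_ = _); congr seval; apply: funext => -[].
rewrite rmorphM; apply: etrans uu; congr (_ * _); first exact: boundary_z.
by apply: etrans (boundary_star _) _; rewrite boundary_z.
Qed.

Lemma sphere_f1_glued : (x, y) \in @glued R p q.
Proof. by apply/gluedP; rewrite /= !boundary_z. Qed.
Lemma sphere_f0_glued : (x * star x, 1) \in @glued R p q.
Proof. by apply/gluedP; rewrite /= boundary_norm rmorph1. Qed.
Lemma sphere_g0_glued : (1, y * star y) \in @glued R p q.
Proof. by apply/gluedP; rewrite /= boundary_norm rmorph1. Qed.

Definition sphere_f1 : S2 := Sub (x, y) sphere_f1_glued.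
Definition sphere_f0 : S2 := Sub (x * star x, 1) sphere_f0_glued.
Definition sphere_g0 : S2 := Sub (1, y * star y) sphere_g0_glued.

Lemma sphere_fst_comm_f0 :
  sphere_fst (sphere_f0 * sphere_f1 - sphere_f1 * sphere_f0) =
  x * star x * x - x * (x * star x).
Proof. by []. Qed.

Lemma sphere_snd_comm_f0 :
  sphere_snd (sphere_f0 * sphere_f1 - sphere_f1 * sphere_f0) = 0.
Proof. by rewrite /sphere_snd /= mul1r mulr1 subrr. Qed.

Lemma sphere_snd_comm_g0 :
  sphere_snd (sphere_g0 * sphere_f1 - sphere_f1 * sphere_g0) =
  y * star y * y - y * (y * star y).
Proof. by []. Qed.

End SphereGenerators.

(** * Contradiction in the (0, 1) entries of two commutators *)

Theorem proposition1p4 (R : realType) (p q mu c : R)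
    (hp : 0 < p < 1) (hq : 0 < q < 1) (hmu : 0 < mu < 1) (hc : 0 < c) :
  ~ star_isomorphic (quantum_sphere p q) (podles_sphere mu hc).
Proof.
case=> f [[g fK gK] _].
have mu0 : mu != 0 by case/andP: hmu => /lt0r_neq0.
pose rp : {lrmorphism quantum_sphere p q -> 'M[R[i]]_2} :=
  disc_rep hp \o @sphere_fst R p q.
pose rq : {lrmorphism quantum_sphere p q -> 'M[R[i]]_2} :=
  disc_rep hq \o @sphere_snd R p q.
pose al := g (podles_A hc).
have rp_al : rp al 0 0 = 0 by apply: tri_rep_podles_A => // x; exact: disc_rep_tri.
have rq_al : rq al 0 0 = 0 by apply: tri_rep_podles_A => // x; exact: disc_rep_tri.
(* The commutator is carried over by [f], divided by A there, and pulled back by [g]. *)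
have comm_al x y : exists s, x * y - y * x = al * s.
  have [u hu] := podles_comm_ideal mu0 hc (f x) (f y); exists (g u).
  by apply: (can_inj fK); rewrite rmorphM /= !gK -hu rmorphB !rmorphM.
have rpq s : rp s 1 1 = rq s 1 1.
  by rewrite /rp /rq /= !disc_rep_boundary boundary_sphere.
have [s hs] := comm_al (sphere_f0 R p q) (sphere_f1 R p q).
have [t ht] := comm_al (sphere_g0 R p q) (sphere_f1 R p q).
have r_neq0 (r : R) : 0 < r < 1 -> r%:C^-1 - 1 != 0 :> R[i].
  case/andP=> r0 r1; rewrite subr_eq0 invr_eq1 -(rmorph1 (real_complex R)).
  by rewrite (inj_eq (fmorph_inj (real_complex R))) lt_eqF.
(* Since [rp al] has (0, 0) entry 0, this product is the whole (0, 1) entry of the first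
   commutator. *)
have hps : rp al 0 1 * rp s 1 1 != 0.
  have -> : rp al 0 1 * rp s 1 1 = rp (al * s) 0 1.
    by rewrite rmorphM mulmx2E rp_al mul0r add0r.
  by rewrite -hs /rp /= sphere_fst_comm_f0 disc_rep_comm mxE r_neq0.
have hqs : rq al 0 1 * rq s 1 1 = 0.
  have -> : rq al 0 1 * rq s 1 1 = rq (al * s) 0 1.
    by rewrite rmorphM mulmx2E rq_al mul0r add0r.
  by rewrite -hs /rq /= sphere_snd_comm_f0 rmorph0 mxE.
have hqt : rq al 0 1 * rq t 1 1 != 0.
  have -> : rq al 0 1 * rq t 1 1 = rq (al * t) 0 1.
    by rewrite rmorphM mulmx2E rq_al mul0r add0r.
  by rewrite -ht /rq /= sphere_snd_comm_g0 disc_rep_comm mxE r_neq0.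
(* By [rpq], [hps] makes the second factor in [hqs] nonzero, so [rq al 0 1] = 0, against [hqt]. *)
move/eqP: hqs; move: hps hqt; rewrite -(rpq s) !mulf_eq0 !negb_or.
by move=> /andP[_ /negPf ->] /andP[/negPf -> _].
Qed.
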